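(* For each of the four E-G strategies (E $\in\{$T, AC$\}$, G $\in\{$C, Y$\}$), suppose the corresponding assumption set $A_{E\text{-}G}$ holds. Then the following oracle inequalities hold for the estimator $\hat f_{F_n}$. (i) For the T-C and T-Y strategies, $$R(\hat f_{F_n};f_0;n)\le c_0\inf_{1\le m\le M_n\wedge n}\Bigl(c_1\inf_{J_m}d^2(f_0;\mathcal{F}_{J_m})+c_2\frac{m}{n_1}+c_3\frac{1+\log\binom{M_n}{m}+\log(M_n\wedge n)-\log(1-p_0)}{n-n_1}\Bigr)\wedge c_0\Bigl(\|f_0\|^2+c_3\frac{1-\log p_0}{n-n_1}\Bigr),$$ where $c_0=1$, $c_1=c_2=C_{L,\sigma}$, $c_3=\frac{2}{\lambda_C}$ for the T-C strategy; $c_0=C_Y$, $c_1=c_2=C_{L,\sigma}$, $c_3=\sigma^2$ for the T-Y strategy. (ii) For the AC-C and AC-Y strategies, $$R(\hat f_{F_n};f_0;n)\le c_0\inf_{1\le m\le M_n\wedge n}\Bigl(R(f_0,m,n)+c_2\frac{m}{n_1}+c_3\frac{1+\log\binom{M_n}{m}+\log(M_n\wedge n)-\log(1-p_0)}{n-n_1}\Bigr)\wedge c_0\Bigl(\|f_0\|^2+c_3\frac{1-\log p_0}{n-n_1}\Bigr),$$ where $$R(f_0,m,n)=c_1\inf_{J_m}\inf_{s\ge1}\Bigl(d^2(f_0;\mathcal{F}^L_{J_m,s})+2c_3\frac{\log(1+s)}{n-n_1}\Bigr),$$ and $c_0=c_1=1$, $c_2=8c(\sigma^2+5L^2)$, $c_3=\frac{2}{\lambda_C}$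 for the AC-C strategy; $c_0=C_Y$, $c_1=1$, $c_2=8c(\sigma^2+5L^2)$, $c_3=\sigma^2$ for the AC-Y strategy.
   Context: MODEL. $n\ge2$, $M_n\ge 2$. $(\mathbf{X}_i,Y_i)_{i=1}^n$ are i.i.d. with $Y_i=f_0(\mathbf{X}_i)+\varepsilon_i$, $\mathbf{X}_i\in\mathcal{X}\subset\mathbb{R}^d$ with distribution $P_X$; the $\varepsilon_i$ are independent of each other and of the $\mathbf{X}_i$, have a density, mean $0$ and variance $\sigma^2<\infty$. $\|\cdot\|$ is the $L_2(P_X)$ norm, and $R(\hat f;f_0;n)=E\|\hat f-f_0\|^2$. The dictionary $F_n=\{f_1,\ldots,f_{M_n}\}$ of given functions satisfies $\|f_j\|\le1$. $d^2(f_0;\mathcal{F})=\inf_{f\in\mathcal{F}}\|f-f_0\|^2$. ASSUMPTIONS. BD: there is a known $L>0$ with $\|f_0\|_\infty\le L$. T1: the errors are normal. T2: $0<\sigma<\infty$ is known. C1, C2: for some $0<\alpha<\infty$ there are known $U_\alpha,V_\alpha<\infty$ with $E e^{\alpha|\varepsilon_i|}\le U_\alpha$ and $E(\varepsilon_i^2e^{\alpha|\varepsilon_i|})/E(e^{\alpha|\varepsilon_i|})\le V_\alpha$. Y1: there are known constants $0<\underline\sigma\le\sigma\le\overline\sigma<\infty$. Y2: the density $h$ of the normalized error $\varepsilon_i/\sigma$ has finite fourth moment and for each $R_0>0$, $0<S_0<1$ there is $B_{S_0,R_0}$ with $\int h(x)\log\frac{h(x)}{S^{-1}h((x-R)/S)}dx\le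 B_{S_0,R_0}((1-S)^2+R^2)$ for all $|R|<R_0$, $S_0\le S\le S_0^{-1}$. $A_{T\text{-}C}$ and $A_{T\text{-}Y}$: BD, T1, T2 (normal errors with known variance satisfy C1, C2, Y1, Y2). $A_{AC\text{-}C}$: BD, C1, C2. $A_{AC\text{-}Y}$: BD, Y1, Y2. THE E-G STRATEGY. Split the data into $Z^{(1)}=(\mathbf{X}_i,Y_i)_{i\le n_1}$, $Z^{(2)}=(\mathbf{X}_i,Y_i)_{n_1<i\le n}$. For each $J_m\subset\{1,\ldots,M_n\}$ of size $m$, $1\le m\le M_n\wedge n$, let $\mathcal{F}_{J_m}=\{\sum_{j\in J_m}\theta_jf_j:\theta\in\mathbb{R}^m\}$ and, for $s\in\mathbb{N}$, $s\ge1$, $\mathcal{F}^L_{J_m,s}=\{f_\theta=\sum_{j\in J_m}\theta_jf_j:\|\theta\|_1\le s,\|f_\theta\|_\infty\le L\}$; $\inf_{J_m}$ is over all subsets of size $m$ and $\inf_{s\ge1}$ over $s\in\mathbb{N}$. First stage. E = T: from $Z^{(1)}$ compute for each $J_m$ a T-estimator (Birgé), i.e. an estimator with values in $[-L,L]$ satisfying $E\|\hat f^{(T)}_{J_m}-f_0\|^2\le C_{L,\sigma}\bigl(\inf_{f\in\mathcal{F}_{J_m}}\|f-f_0\|^2+m/n_1\bigr)$, with $C_{L,\sigma}$ depending only on $L,\sigma$. E = AC: from $Z^{(1)}$ compute for each $(J_m,s)$ an AC-estimator (Audibert–Catoni), i.e. an estimator with values in $[-L,L]$ satisfying $E\|\hat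 f^{(AC)}_{J_m,s}-f_0\|^2\le\inf_{g\in\mathcal{F}^L_{J_m,s}}\|g-f_0\|^2+c(2\sigma'+H)^2m/n_1$, with $c$ a pure constant, $(\sigma')^2=\sigma^2+4L^2$, $H=\sup_{f,f'\in\mathcal{F}^L_{J_m,s},\mathbf{x}}|f(\mathbf{x})-f'(\mathbf{x})|\le 2L$. Second stage. Fix $p_0\in(0,1)$. The first-stage estimators and the null model $f\equiv0$ are aggregated using $Z^{(2)}$ by algorithm G with prior weights $\pi_0=p_0$ for the null model and $\pi_{J_m}=(1-p_0)\bigl((M_n\wedge n)\binom{M_n}{m}\bigr)^{-1}$ (E = T) or $\pi_{J_m,s}=(1-p_0)\bigl((1+s)^2(M_n\wedge n)\binom{M_n}{m}\bigr)^{-1}$ (E = AC); sub-probability weights are allowed. The result is $\hat f_{F_n}$. Algorithms (applied to candidates $\check f_k$, $\|\check f_k\|_\infty\le L$, fixed given $Z^{(1)}$, weights $\pi_k$, and $N=n-n_1$ new observations relabelled $i=1,\ldots,N$). G = C (Catoni): $\hat f^C=\sum_kW_k\check f_k$, $W_k=\frac1N\sum_{l=1}^N\frac{\pi_k\prod_{i\le l}q_k(Y_i|\mathbf{X}_i)}{\sum_j\pi_j\prod_{i\le l}q_j(Y_i|\mathbf{X}_i)}$, $q_k(Y|\mathbf{X})=\sqrt{\lambda_C/2\pi}\exp\{-\frac{\lambda_C}{2}(Y-\check f_k(\mathbf{X}))^2\}$, $\lambda_C=\min\{\frac{\alpha}{2L},(U_\alpha(17L^2+3.4V_\alpha))^{-1}\}$;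 its recalled guarantee is $E\|\hat f^C-f_0\|^2\le\inf_k\bigl(\|\check f_k-f_0\|^2+\frac{2}{N\lambda_C}\log\frac1{\pi_k}\bigr)$. G = Y (ARM): split the $N$ observations at $N_1=\lceil N/2\rceil$; let $\hat\sigma_k^2=\frac1{N_1}\sum_{i\le N_1}(Y_i-\check f_k(\mathbf{X}_i))^2$ clipped to $[\underline\sigma^2,\overline\sigma^2]$; for $N_1<l\le N$ let $E_{k,l}=\hat\sigma_k^{-(l-N_1)}\prod_{i=N_1+1}^lh((Y_i-\check f_k(\mathbf{X}_i))/\hat\sigma_k)$; $\hat f^Y=\sum_kW_k\check f_k$ with $W_k=\frac1{N-N_1}\sum_{l=N_1+1}^N\frac{\pi_kE_{k,l}}{\sum_j\pi_jE_{j,l}}$ (if $\sigma$ is known, $\hat\sigma_k=\sigma$ and no splitting is needed); its recalled guarantee is $E\|\hat f^Y-f_0\|^2\le C_Y\inf_k\bigl(\|\check f_k-f_0\|^2+\frac{\sigma^2}{N}(1+\log\frac1{\pi_k})\bigr)$, with $C_Y$ depending on $\underline\sigma,\overline\sigma,L,h$ only. The recalled guarantees of the T-, AC-, Catoni and ARM procedures are part of the specification of the strategy, and $C_{L,\sigma}$, $c$, $\lambda_C$, $C_Y$ in the claim are the constants appearing here. *)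

(* Defs.v *)
From HB Require Import structures.
From mathcomp Require Export all_boot all_order all_algebra.
From mathcomp Require Export all_classical all_reals all_analysis.
Export Order.TTheory GRing.Theory Num.Theory.
Export numFieldNormedType.Exports.

Set Implicit Arguments.
Unset Strict Implicit.
Unset Printing Implicit Defensive.

Local Open Scope classical_set_scope.
Local Open Scope ring_scope.

Section independence.
Context (R : realType) (dO : measure_display) (Omega : measurableType dO).
Variable P : probability Omega R.

Definition mutually_independent (I : finType) (G : I -> set (set Omega)) :=
  forall (J : {set I}) (E : I -> set Omega),
    (forall i, i \in J -> G i (E i)) ->
    P (\bigcap_(i in [set` J]) E i) = (\prod_(i in J) P (E i))%E.

Definition sigma_of (d : measure_display) (T : measurableType d)
    (X : Omega -> T) : set (set Omega) :=
  preimage_set_system setT X measurable.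

End independence.

(* The sum of an absolutely summable family, as the difference of the sums of
   its positive and negative parts. *)
Definition csum (R : realType) (K : countType) (a : K -> R) : R :=
  fine (\esum_(k in [set: K]) (Num.max (a k) 0)%:E)
  - fine (\esum_(k in [set: K]) (Num.max (- a k) 0)%:E).

Section norms.
Context (R : realType) (d : nat).
Local Notation Rd := (d.-tuple R).
Variable PX : probability Rd R.
Local Open Scope ereal_scope.

Definition sqnorm (f : Rd -> R) : \bar R :=
  'N[PX]_(2%:R)%:E [EFin \o f] ^+ 2.

Definition sqdist (f g : Rd -> R) : \bar R := sqnorm (fun x => (f x - g x)%R).

(* d^2(f0; FF) *)
Definition sqdist_to (f0 : Rd -> R) (FF : set (Rd -> R)) : \bar R :=
  ereal_inf [set sqdist f f0 | f in FF].

(* ||f||_oo is the supremum over the design domain, not an essential one. *)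
Definition supnorm (Xdom : set Rd) (f : Rd -> R) : \bar R :=
  ereal_sup [set `|f x|%:E | x in Xdom].

End norms.

Section regression.
Context (R : realType) (d n : nat) (dO : measure_display).
Context (Omega : measurableType dO) (P : probability Omega R).
Local Notation Rd := (d.-tuple R).
Variables (Xdom : set Rd) (PX : probability Rd R).
Variables (X : 'I_n -> {RV P >-> Rd}) (eps : 'I_n -> {RV P >-> R}).
Variables (f0 : Rd -> R) (sigma : R) (h : R -> R).

(* Functions on the domain Xdom are represented by functions on R^d; only
   their values on Xdom, which carries P_X, matter.  The responses are
   Y_i = f0(X_i) + eps_i, see [obs].  [h] is a density of eps_i / sigma. *)
Record regression_model : Prop := RegressionModel {
  rm_dom : measurable Xdom ;
  rm_supp : PX Xdom = 1%E ;
  rm_law_X : forall i (A : set Rd), measurable A -> distribution P (X i) A = PX A ;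
  rm_indep : mutually_independent P
    (fun i : 'I_n + 'I_n => match i with
                            | inl j => sigma_of (X j)
                            | inr j => sigma_of (eps j)
                            end) ;
  rm_f0 : measurable_fun [set: Rd] f0 ;
  rm_sigma : 0 <= sigma ;
  rm_mean : forall i, ('E_P[eps i] = 0)%E ;
  rm_var : forall i, ('V_P[eps i] = (sigma ^+ 2)%:E)%E ;
  rm_h_ge0 : forall x, 0 <= h x ;
  rm_h_meas : measurable_fun [set: R] h ;
  rm_density : forall i (A : set R), measurable A ->
    P [set w | A (eps i w / sigma)]
    = (\int[lebesgue_measure]_(x in A) (h x)%:E)%E
}.

Definition obs (i : 'I_n) (w : Omega) : Rd * R := (X i w, f0 (X i w) + eps i w).

Definition sample1 (n1 : nat) (h1 : (n1 <= n)%N) (w : Omega) :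
    n1.-tuple (Rd * R) :=
  [tuple obs (cast_ord (subnKC h1) (lshift (n - n1) i)) w | i < n1].

Definition sample2 (n1 : nat) (h1 : (n1 <= n)%N) (w : Omega) :
    (n - n1).-tuple (Rd * R) :=
  [tuple obs (cast_ord (subnKC h1) (rshift n1 i)) w | i < n - n1].

Definition risk (fhat : Omega -> Rd -> R) : \bar R :=
  (\int[P]_w sqdist PX (fhat w) f0)%E.

Definition cond_BD (L : R) := 0 < L /\ (supnorm Xdom f0 <= L%:E)%E.

Definition cond_T1 := forall i (A : set R), measurable A ->
  distribution P (eps i) A = normal_prob 0 sigma A.

Definition cond_T2 := 0 < sigma.

Definition cond_C1 (alpha U : R) := 0 < alpha /\
  forall i, ('E_P[fun w => expR (alpha * `|eps i w|)] <= U%:E)%E.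

Definition cond_C2 (alpha V : R) := 0 < alpha /\
  forall i, ('E_P[fun w => (eps i w ^+ 2 * expR (alpha * `|eps i w|))%R]
             / 'E_P[fun w => expR (alpha * `|eps i w|)] <= V%:E)%E.

Definition cond_Y1 (slo shi : R) := [/\ 0 < slo, slo <= sigma & sigma <= shi].

(* a log (a / b), with 0 log (0 / b) = 0 and a log (a / 0) = +oo for a > 0 *)
Definition kl_integrand (a b : R) : \bar R :=
  if a == 0 then 0%E else if b == 0 then +oo%E else (a * ln (a / b))%:E.

Definition cond_Y2 :=
  (\int[lebesgue_measure]_x (x ^+ 4 * h x)%:E < +oo)%E /\
  forall R0 S0 : R, 0 < R0 -> 0 < S0 -> S0 < 1 ->
  exists B : R, forall r S : R, `|r| < R0 -> S0 <= S -> S <= S0^-1 ->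
    (\int[lebesgue_measure]_x kl_integrand (h x) (S^-1 * h ((x - r) / S))
     <= (B * ((1 - S) ^+ 2 + r ^+ 2))%:E)%E.

End regression.

Section aggregation.
Context (R : realType) (d N : nat).
Local Notation Rd := (d.-tuple R).

Definition aggregation := forall K : countType,
  (K -> R) -> (K -> Rd -> R) -> N.-tuple (Rd * R) -> Rd -> R.

Definition lambdaC (L alpha U V : R) : R :=
  Num.min (alpha / (2 * L)) (U * (17 * L ^+ 2 + 34 / 10 * V))^-1.

(* Observations are numbered from 0: l : 'I_N stands for the (l+1)-st one. *)

Definition catoni_q (lam : R) (f : Rd -> R) (xy : Rd * R) : R :=
  Num.sqrt (lam / (2 * pi)) * expR (- (lam / 2 * (xy.2 - f xy.1) ^+ 2)).

Definition catoni_lik (lam : R) (f : Rd -> R) (z : N.-tuple (Rd * R))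
    (l : 'I_N) : R :=
  \prod_(i < N | (i <= l)%N) catoni_q lam f (tnth z i).

Definition catoni_weight (lam : R) (K : countType) (w : K -> R)
    (f : K -> Rd -> R) (z : N.-tuple (Rd * R)) (k : K) : R :=
  N%:R^-1 * \sum_(l < N) (w k * catoni_lik lam (f k) z l
                          / csum (fun j => w j * catoni_lik lam (f j) z l)).

Definition catoni (lam : R) : aggregation := fun K w f z x =>
  csum (fun k => catoni_weight lam w f z k * f k x).

(* ARM with the scale estimated on a first half of the observations, or its
   variant for known sigma, which uses sigma and needs no splitting. *)
Inductive arm_version := ArmSplit | ArmKnownSigma.

Definition arm_N1 (v : arm_version) : nat :=
  match v with ArmSplit => uphalf N | ArmKnownSigma => 0 end.

Definition arm_sigma (v : arm_version) (sigma slo shi : R) (f : Rd -> R)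
    (z : N.-tuple (Rd * R)) : R :=
  match v with
  | ArmSplit =>
      Num.sqrt (Num.min (shi ^+ 2) (Num.max (slo ^+ 2)
        ((arm_N1 v)%:R^-1 * \sum_(i < N | (i < arm_N1 v)%N)
           ((tnth z i).2 - f (tnth z i).1) ^+ 2)))
  | ArmKnownSigma => sigma
  end.

Definition arm_lik (v : arm_version) (sigma slo shi : R) (h : R -> R)
    (f : Rd -> R) (z : N.-tuple (Rd * R)) (l : 'I_N) : R :=
  let s := arm_sigma v sigma slo shi f z in
  s ^- (l.+1 - arm_N1 v) *
  \prod_(i < N | (arm_N1 v <= i <= l)%N)
    h (((tnth z i).2 - f (tnth z i).1) / s).

Definition arm_weight (v : arm_version) (sigma slo shi : R) (h : R -> R)
    (K : countType) (w : K -> R) (f : K -> Rd -> R)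
    (z : N.-tuple (Rd * R)) (k : K) : R :=
  (N - arm_N1 v)%:R^-1 * \sum_(l < N | (arm_N1 v <= l)%N)
    (w k * arm_lik v sigma slo shi h (f k) z l
     / csum (fun j => w j * arm_lik v sigma slo shi h (f j) z l)).

Definition arm (v : arm_version) (sigma slo shi : R) (h : R -> R) :
    aggregation := fun K w f z x =>
  csum (fun k => arm_weight v sigma slo shi h w f z k * f k x).

Definition sub_probability (K : countType) (w : K -> R) :=
  (forall k, 0 < w k) /\ (\esum_(k in [set: K]) (w k)%:E <= 1)%E.

Definition bounded_candidates (Xdom : set Rd) (L : R) (K : countType)
    (f : K -> Rd -> R) :=
  forall k, measurable_fun [set: Rd] (f k) /\ (supnorm Xdom (f k) <= L%:E)%E.

End aggregation.

Section guarantees.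
Context (R : realType) (d N : nat) (dO : measure_display).
Context (Omega : measurableType dO) (P : probability Omega R).
Local Notation Rd := (d.-tuple R).
Variables (Xdom : set Rd) (PX : probability Rd R) (f0 : Rd -> R) (L : R).
Variable (Z : Omega -> N.-tuple (Rd * R)).

(* The candidates are deterministic: with data-driven candidates built from an
   independent sample, the bounds apply conditionally on that sample. *)

Definition catoni_guarantee (lam : R) :=
  forall (K : countType) (w : K -> R) (f : K -> Rd -> R),
    sub_probability w -> bounded_candidates Xdom L f ->
    (risk P PX f0 (fun om => catoni lam w f (Z om))
     <= ereal_inf [set sqdist PX (f k) f0
                       + (2 / (N%:R * lam) * ln (1 / w k))%:E | k in [set: K]])%E.

Definition arm_guarantee (v : arm_version) (sigma slo shi : R) (h : R -> R)
    (CY : R) :=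
  forall (K : countType) (w : K -> R) (f : K -> Rd -> R),
    sub_probability w -> bounded_candidates Xdom L f ->
    (risk P PX f0 (fun om => arm v sigma slo shi h w f (Z om))
     <= CY%:E *
        ereal_inf [set sqdist PX (f k) f0
                       + (sigma ^+ 2 / N%:R * (1 + ln (1 / w k)))%:E
                  | k in [set: K]])%E.

End guarantees.

Section EG_strategies.
Context (R : realType) (d n M : nat).
Local Notation Rd := (d.-tuple R).
Variable F : 'I_M -> Rd -> R.

Definition lincomb (J : {set 'I_M}) (theta : 'I_M -> R) : Rd -> R :=
  fun x => \sum_(j in J) theta j * F j x.

Definition lin_class (J : {set 'I_M}) : set (Rd -> R) :=
  [set f | exists theta : 'I_M -> R, f = lincomb J theta].

Definition ball_class (Xdom : set Rd) (L : R) (J : {set 'I_M}) (s : nat) :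
    set (Rd -> R) :=
  [set f | exists theta : 'I_M -> R,
     [/\ f = lincomb J theta, \sum_(j in J) `|theta j| <= s%:R
       & (supnorm Xdom f <= L%:E)%E]].

Definition ball_width (Xdom : set Rd) (L : R) (J : {set 'I_M}) (s : nat) : R :=
  sup [set r : R | exists f g x, [/\ ball_class Xdom L J s f,
         ball_class Xdom L J s g, Xdom x & r = `|f x - g x|]].

Definition admissible_size (m : nat) : bool := (1 <= m <= minn M n)%N.

(* Candidates of the second stage; None is the null model. *)
Definition T_index := {J : {set 'I_M} | admissible_size #|J|}.
Definition AC_index :=
  {Js : {set 'I_M} * nat | admissible_size #|Js.1| && (1 <= Js.2)%N}.

Definition T_candidates (g : {set 'I_M} -> Rd -> R) (k : option T_index) :
    Rd -> R :=
  if k is Some J then g (val J) else fun=> 0.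

Definition AC_candidates (g : {set 'I_M} -> nat -> Rd -> R)
    (k : option AC_index) : Rd -> R :=
  if k is Some Js then g (val Js).1 (val Js).2 else fun=> 0.

Definition T_prior (p0 : R) (k : option T_index) : R :=
  if k is Some J
  then (1 - p0) * ((minn M n)%:R * 'C(M, #|val J|)%:R)^-1 else p0.

Definition AC_prior (p0 : R) (k : option AC_index) : R :=
  if k is Some Js
  then (1 - p0) * ((1 + (val Js).2%:R) ^+ 2 * (minn M n)%:R
                   * 'C(M, #|(val Js).1|)%:R)^-1
  else p0.

Definition T_strategy (N n1 : nat) (G : aggregation R d N) (p0 : R)
    (fT : {set 'I_M} -> n1.-tuple (Rd * R) -> Rd -> R)
    (z1 : n1.-tuple (Rd * R)) (z2 : N.-tuple (Rd * R)) : Rd -> R :=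
  G (option T_index) (T_prior p0) (T_candidates (fun J => fT J z1)) z2.

Definition AC_strategy (N n1 : nat) (G : aggregation R d N) (p0 : R)
    (fAC : {set 'I_M} -> nat -> n1.-tuple (Rd * R) -> Rd -> R)
    (z1 : n1.-tuple (Rd * R)) (z2 : N.-tuple (Rd * R)) : Rd -> R :=
  G (option AC_index) (AC_prior p0) (AC_candidates (fun J s => fAC J s z1)) z2.

Variables (Xdom : set Rd) (PX : probability Rd R) (f0 : Rd -> R).
Variables (sigma L : R).

Definition bounded_estimator (n1 : nat) (g : n1.-tuple (Rd * R) -> Rd -> R) :=
  measurable_fun [set: n1.-tuple (Rd * R) * Rd] (fun zx => g zx.1 zx.2) /\
  forall z x, Xdom x -> `|g z x| <= L.

Section first_stage.
Context (dO : measure_display) (Omega : measurableType dO).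
Variables (P : probability Omega R) (n1 : nat).
Variable (Z1 : Omega -> n1.-tuple (Rd * R)).

Definition T_estimators (C : R)
    (fT : {set 'I_M} -> n1.-tuple (Rd * R) -> Rd -> R) :=
  forall J : {set 'I_M}, admissible_size #|J| ->
    bounded_estimator (fT J) /\
    (risk P PX f0 (fun om => fT J (Z1 om))
     <= C%:E * (sqdist_to PX f0 (lin_class J) + (#|J|%:R / n1%:R)%:E))%E.

Definition AC_estimators (c : R)
    (fAC : {set 'I_M} -> nat -> n1.-tuple (Rd * R) -> Rd -> R) :=
  forall (J : {set 'I_M}) (s : nat), admissible_size #|J| -> (1 <= s)%N ->
    bounded_estimator (fAC J s) /\
    (risk P PX f0 (fun om => fAC J s (Z1 om))
     <= sqdist_to PX f0 (ball_class Xdom L J s)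
        + (c * (2 * Num.sqrt (sigma ^+ 2 + 4 * L ^+ 2)
                + ball_width Xdom L J s) ^+ 2 * (#|J|%:R / n1%:R))%:E)%E.

End first_stage.

Definition oracle_penalty (n1 m : nat) (p0 c2 c3 : R) : R :=
  c2 * (m%:R / n1%:R)
  + c3 * ((1 + ln ('C(M, m)%:R) + ln ((minn M n)%:R) - ln (1 - p0))
          / (n - n1)%:R).

Definition null_bound (n1 : nat) (p0 c3 : R) : \bar R :=
  (sqnorm PX f0 + (c3 * ((1 - ln p0) / (n - n1)%:R))%:E)%E.

Definition T_oracle (n1 : nat) (p0 c0 c1 c2 c3 : R) : \bar R :=
  (Order.min
     (c0%:E * ereal_inf
        [set c1%:E * ereal_inf [set sqdist_to PX f0 (lin_class J)
                               | J in [set J : {set 'I_M} | #|J| = m]]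
             + (oracle_penalty n1 m p0 c2 c3)%:E
        | m in [set m : nat | admissible_size m]])
     (c0%:E * null_bound n1 p0 c3))%E.

Definition AC_approx (n1 m : nat) (c1 c3 : R) : \bar R :=
  (c1%:E * ereal_inf
     [set ereal_inf
        [set sqdist_to PX f0 (ball_class Xdom L J s)
             + (2 * c3 * (ln (1 + s%:R) / (n - n1)%:R))%:E
        | s in [set s : nat | (1 <= s)%N]]
     | J in [set J : {set 'I_M} | #|J| = m]])%E.

Definition AC_oracle (n1 : nat) (p0 c0 c1 c2 c3 : R) : \bar R :=
  (Order.min
     (c0%:E * ereal_inf
        [set AC_approx n1 m c1 c3 + (oracle_penalty n1 m p0 c2 c3)%:E
        | m in [set m : nat | admissible_size m]])
     (c0%:E * null_bound n1 p0 c3))%E.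

End EG_strategies.

(* Main.v *)
From HB Require Import structures.
Require Import Defs.
From mathcomp Require Import measurable_realfun ring.

(** Given the first half [Z1] of the data the first-stage estimators are fixed
functions, and [Z2] is independent of [Z1]; so the guarantee of the aggregation
algorithm, which is stated for deterministic candidates, applies conditionally
on [Z1].  Integrating it over [Z1] gives, for every candidate [k] with prior
weight [w k],
   risk of the aggregate
     <= c0 (risk of candidate k + c3 (1 + log (1 / w k)) / (n - n1)),
which is [aggregate_risk].  Both Catoni's and the ARM guarantee have this form,
the former with c0 = 1 after a harmless 1 is added to the logarithm.  It remains
to insert the guarantee of the first-stage estimator, to compute
log (1 / w k), and to take the infimum over k; the null model yields the second
term of the minimum.

Integrating over [Z1] is Tonelli's theorem, and two things must be known.
The joint law of [Z1] and [Z2] is the product of their laws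
([subsamples_independent]): the model only gives the mutual independence of the
single variables X_i and eps_i, and the passage to the two blocks is the usual
argument on pi-systems.  The aggregate must be jointly measurable in [Z1], [Z2]
and the design point ([catoni_jointly_measurable], [arm_jointly_measurable]),
in spite of its being a quotient of sums over possibly countably many models.

The arithmetic facts are that the weights are subprobabilities, since there are
'C(M, m) models of size m and sum_(s >= 1) (1 + s)^-2 <= 1; that the constant of
Catoni's algorithm is positive; and that
(2 sigma' + H)^2 <= (2 sigma' + 2 L)^2 <= 8 (sigma'^2 + L^2)
                  = 8 (sigma^2 + 5 L^2). *)

Set Implicit Arguments.
Unset Strict Implicit.
Unset Printing Implicit Defensive.
Local Open Scope classical_set_scope.
Local Open Scope ring_scope.

(** * Measurability of the aggregation algorithms *)

Section measurability.
Context (R : realType).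

Lemma measurable_sqrt : measurable_fun [set: R] (@Num.sqrt R).
Proof.
by apply: continuous_measurable_fun; exact: sqrt_continuous.
Qed.

(** Writing 1/x as x times a real power of x^2 reduces the claim to the
measurability of real powers. *)
Lemma measurable_inv : measurable_fun [set: R] (fun x : R => x^-1).
Proof.
have -> : (fun x : R => x^-1) = (fun x => x * (x ^+ 2) `^ (-1)).
  apply/funext => x; rewrite powR_inv1 ?sqr_ge0//.
  have [->|x0] := eqVneq x 0; first by rewrite invr0 mul0r.
  by rewrite expr2 invfM mulrA divff// mul1r.
apply: measurable_funM => //; apply: (measurableT_comp (measurable_powR (-1))).
exact: measurable_funX.
Qed.

(** A sum over a countable type is a series, once the type is numbered by
[pickle]. *)
Lemma measurable_fun_esum (dU : measure_display) (U : measurableType dU)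
    (K : countType) (a : K -> U -> \bar R) :
  (forall k u, (0 <= a k u)%E) -> (forall k, measurable_fun [set: U] (a k)) ->
  measurable_fun [set: U] (fun u => \esum_(k in [set: K]) a k u).
Proof.
move=> a0 ma.
(* numbers that code no element of K contribute 0 *)
pose b n u := oapp (a ^~ u) 0%E (@pickle_inv K n).
have b0 n u : (0 <= b n u)%E by rewrite /b; case: pickle_inv => /=.
have mb n : measurable_fun [set: U] (b n).
  by rewrite /b; case: pickle_inv => [k|] /=; [exact: ma|exact: measurable_cst].
have -> : (fun u => \esum_(k in [set: K]) a k u)
        = (fun u => (\sum_(n <oo | n \in xpredT) b n u)%E).
  apply/funext => u; rewrite -[RHS]/(\sum_(n <oo) b n u)%E.
  rewrite nneseries_esumT//.
  rewrite -[LHS](eq_esum (a := fun k => b (pickle k) u)); last first.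
    by move=> k _; rewrite /b pickleK_inv.
  rewrite -(esum_image [set: K] pickle (b ^~ u)); last first.
    by move=> k l _ _; apply: (pcan_inj pickleK).
  rewrite esum_mkcond; apply: eq_esum => n _; case: ifPn => // nK.
  rewrite /b; case E : pickle_inv => [k|] //=; exfalso.
  move/negP: nK; apply; rewrite inE; exists k => //.
  by have := @pickle_invK K n; rewrite E.
by apply: ge0_emeasurable_sum => //.
Qed.

Lemma measurable_csum (dU : measure_display) (U : measurableType dU)
    (K : countType) (a : K -> U -> R) :
  (forall k, measurable_fun [set: U] (a k)) ->
  measurable_fun [set: U] (fun u => csum (a ^~ u)).
Proof.
have aux (c : K -> U -> R) : (forall k, measurable_fun [set: U] (c k)) ->
    measurable_fun [set: U]
      (fun u => fine (\esum_(k in [set: K]) (Num.max (c k u) 0)%:E)).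
  move=> mc; apply: (measurableT_comp (fine_measurable measurableT)).
  apply: measurable_fun_esum => [k u|k].
    by rewrite lee_fin le_max lexx orbT.
  by apply/measurable_EFinP; apply: measurable_maxr.
move=> ma; apply: measurable_funB; apply: aux => // k.
exact: measurable_funN.
Qed.

Lemma measurable_sum_cond (dU : measure_display) (U : measurableType dU)
    (I : finType) (P : pred I) (a : I -> U -> R) :
  (forall i, P i -> measurable_fun [set: U] (a i)) ->
  measurable_fun [set: U] (fun u => \sum_(i | P i) a i u).
Proof.
move=> ma; rewrite (_ : (fun u => _) =
  fun u => \sum_(i : I) if P i then a i u else 0).
  apply: measurable_sum => i; case: (boolP (P i)) => [/ma//|_].
  exact: measurable_cst.
by apply/funext => u; exact: big_mkcond.
Qed.

Lemma measurable_prod_cond (dU : measure_display) (U : measurableType dU)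
    (I : finType) (P : pred I) (a : I -> U -> R) :
  (forall i, P i -> measurable_fun [set: U] (a i)) ->
  measurable_fun [set: U] (fun u => \prod_(i | P i) a i u).
Proof.
move=> ma; rewrite (_ : (fun u => _) =
  fun u => \prod_(i : I) if P i then a i u else 1).
  apply: measurable_prod => i _; case: (boolP (P i)) => [/ma//|_].
  exact: measurable_cst.
by apply/funext => u; exact: big_mkcond.
Qed.

End measurability.

Section aggregation_measurability.
Context (R : realType) (d N : nat).
Local Notation Rd := (d.-tuple R).

(** Algorithms take candidates and data as separate arguments, so measurability
is required along every measurable way of letting candidates, data and
evaluation point depend on a common parameter.  For the aggregate the parameter
is the triple of the first sample, the second sample and the point. *)
Definition jointly_measurable (G : aggregation R d N) : Prop :=
  forall (dU : measure_display) (U : measurableType dU) (K : countType)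
    (w : K -> R) (f : K -> U -> Rd -> R) (z : U -> N.-tuple (Rd * R))
    (x : U -> Rd),
    (forall k, measurable_fun [set: U * Rd] (fun p => f k p.1 p.2)) ->
    measurable_fun [set: U] z -> measurable_fun [set: U] x ->
    measurable_fun [set: U] (fun u => G K w (f ^~ u) (z u) (x u)).

Section candidate.
Context (dU : measure_display) (U : measurableType dU).
Variables (g : U -> Rd -> R) (z : U -> N.-tuple (Rd * R)).
Hypothesis mg : measurable_fun [set: U * Rd] (fun p => g p.1 p.2).
Hypothesis mz : measurable_fun [set: U] z.

Lemma measurable_fun_at (x : U -> Rd) : measurable_fun [set: U] x ->
  measurable_fun [set: U] (fun u => g u (x u)).
Proof.
move=> mx; apply: (measurableT_comp mg (g := fun u => (u, x u))).
by apply: measurable_fun_pair.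
Qed.

Let mzi i : measurable_fun [set: U] (fun u => tnth (z u) i).
Proof. exact: (measurableT_comp (measurable_tnth i) mz). Qed.

Lemma measurable_residual i :
  measurable_fun [set: U] (fun u => (tnth (z u) i).2 - g u (tnth (z u) i).1).
Proof.
apply: measurable_funB; first exact: (measurableT_comp measurable_snd (mzi i)).
by apply: measurable_fun_at; exact: (measurableT_comp measurable_fst (mzi i)).
Qed.

Lemma measurable_catoni_lik lam l :
  measurable_fun [set: U] (fun u => catoni_lik lam (g u) (z u) l).
Proof.
apply: measurable_prod_cond => i _.
apply: measurable_funM; first exact: measurable_cst.
rewrite /catoni_q; apply: (measurableT_comp (f := expR)).
  exact: measurable_expR.
apply: measurable_funN; apply: measurable_funM; first exact: measurable_cst.
by apply: measurable_funX; exact: measurable_residual.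
Qed.

Lemma measurable_arm_lik v sigma slo shi (h : R -> R) l :
  measurable_fun [set: R] h ->
  measurable_fun [set: U] (fun u => arm_lik v sigma slo shi h (g u) (z u) l).
Proof.
move=> mh.
have ms : measurable_fun [set: U]
    (fun u => arm_sigma v sigma slo shi (g u) (z u)).
  case: v => /=; last exact: measurable_cst.
  apply: (measurableT_comp (@measurable_sqrt R)).
  apply: measurable_minr; first exact: measurable_cst.
  apply: measurable_maxr; first exact: measurable_cst.
  apply: measurable_funM; first exact: measurable_cst.
  apply: measurable_sum_cond => i _.
  by apply: measurable_funX; exact: measurable_residual.
apply: measurable_funM.
  by apply: (measurableT_comp (@measurable_inv R)); exact: measurable_funX.
apply: measurable_prod_cond => i _.
apply: (measurableT_comp mh); apply: measurable_funM.
  exact: measurable_residual.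
exact: (measurableT_comp (@measurable_inv R)).
Qed.

End candidate.

Lemma catoni_jointly_measurable lam : jointly_measurable (@catoni R d N lam).
Proof.
move=> dU U K w f z x mf mz mx; apply: measurable_csum => k.
apply: measurable_funM; last exact: (measurable_fun_at (mf k)).
apply: measurable_funM; first exact: measurable_cst.
have ml j l : measurable_fun [set: U]
    (fun u => w j * catoni_lik lam (f j u) (z u) l).
  apply: measurable_funM; first exact: measurable_cst.
  exact: (measurable_catoni_lik (mf j)).
apply: measurable_sum => l; apply: measurable_funM; first exact: ml.
by apply: (measurableT_comp (@measurable_inv R)); apply: measurable_csum.
Qed.

Lemma arm_jointly_measurable v sigma slo shi (h : R -> R) :
  measurable_fun [set: R] h ->
  jointly_measurable (@arm R d N v sigma slo shi h).
Proof.
move=> mh dU U K w f z x mf mz mx; apply: measurable_csum => k.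
apply: measurable_funM; last exact: (measurable_fun_at (mf k)).
apply: measurable_funM; first exact: measurable_cst.
have ml j l : measurable_fun [set: U]
    (fun u => w j * arm_lik v sigma slo shi h (f j u) (z u) l).
  apply: measurable_funM; first exact: measurable_cst.
  exact: (measurable_arm_lik (mf j)).
apply: measurable_sum_cond => l _.
apply: measurable_funM; first exact: ml.
by apply: (measurableT_comp (@measurable_inv R)); apply: measurable_csum.
Qed.

End aggregation_measurability.

(** * Independence of the two samples *)

Section blocks.
Context (R : realType) (dO : measure_display) (Omega : measurableType dO).
Variable P : probability Omega R.

(** As functions of [A] both sides are finite measures that agree on the
pi-system [C]. *)
Lemma independent_g_sigma_algebra (C : set (set Omega)) (B : set Omega) :
  C `<=` measurable -> setI_closed C -> C setT -> measurable B ->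
  (forall A, C A -> P (A `&` B) = (P A * P B)%E) ->
  forall A, <<s C >> A -> P (A `&` B) = (P A * P B)%E.
Proof.
move=> Cm CI CT mB CB A sCA.
have PBfin : P B \is a fin_num by exact: fin_num_measure.
have PB0 : 0 <= fine (P B) by rewrite fine_ge0.
have covT : \bigcup_(k in [set: nat]) [set: Omega] = setT.
  by rewrite bigcup_const//; exists 0%N.
(* the measures A |-> P (A and B) and A |-> P B * P A *)
have : mrestr P mB A = mscale (NngNum PB0) P A.
  apply: (g_sigma_algebra_measure_unique C Cm (fun=> setT)) => //.
  - move=> D CD; change (P (D `&` B) = (fine (P B))%:E * P D)%E.
    by rewrite fineK// CB// muleC.
  - move=> _; change (P (setT `&` B) < +oo)%E.
    by rewrite setTI ltey_eq PBfin.
change ((P (A `&` B) = (fine (P B))%:E * P A)%E ->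
  P (A `&` B) = (P A * P B)%E).
by rewrite fineK// muleC.
Qed.

Section cylinders.
Context (I : finType) (G : I -> set (set Omega)).
Hypothesis indepG : mutually_independent P G.
Hypothesis mG : forall i, G i `<=` measurable.
Hypothesis GI : forall i, setI_closed (G i).
Hypothesis GT : forall i, G i setT.

Definition cylinders (S : {set I}) : set (set Omega) :=
  [set A | exists E : I -> set Omega,
     (forall i, G i (E i)) /\ A = \bigcap_(i in [set` S]) E i].

Lemma cylinders_measurable S : cylinders S `<=` measurable.
Proof.
move=> A [E [GE ->]]; apply: fin_bigcap_measurable => // i _.
exact/mG/GE.
Qed.

Lemma cylinders_setI S : setI_closed (cylinders S).
Proof.
move=> _ _ [E [GE ->]] [F [GF ->]]; exists (fun i => E i `&` F i); split.
  by move=> i; exact: GI.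
by rewrite bigcapI.
Qed.

Lemma cylinders_setT S : cylinders S setT.
Proof. by exists (fun=> setT); split => //; rewrite bigcapT. Qed.

Lemma cylinders_one (S : {set I}) i A : i \in S -> G i A -> cylinders S A.
Proof.
move=> iS GA; exists (fun j => if j == i then A else setT); split.
  by move=> j; case: eqP => [->|].
rewrite eqEsubset; split=> [x Ax j _|x]; first by case: eqP.
by move=> /(_ i iS); rewrite eqxx.
Qed.

(** Choosing [E] on [S] and [F] on [T] makes the intersection of the two
cylinders one cylinder over the union of [S] and [T]. *)
Lemma cylinders_independent (S T : {set I}) A B :
  (forall i, i \in S -> i \notin T) ->
  cylinders S A -> cylinders T B -> P (A `&` B) = (P A * P B)%E.
Proof.
move=> ST [E [GE ->]] [F [GF ->]].
pose H i := if i \in S then E i else F i.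
have GH i : G i (H i) by rewrite /H; case: ifP.
have HE i : i \in S -> H i = E i by rewrite /H => ->.
have HF i : i \in T -> H i = F i.
  by rewrite /H => iT; case: ifP => // /ST; rewrite iT.
have -> : \bigcap_(i in [set` S]) E i `&` \bigcap_(i in [set` T]) F i
        = \bigcap_(i in [set` (S :|: T)%SET]) H i.
  rewrite eqEsubset; split=> [x [xE xF] i /=|x xH].
    rewrite inE => /orP[iS|iT]; first by rewrite HE//; exact: xE.
    by rewrite HF//; exact: xF.
  split=> i /= iST; first by rewrite -HE//; apply: xH; rewrite /= inE iST.
  by rewrite -HF//; apply: xH; rewrite /= inE iST orbT.
rewrite !indepG// big_mkcond/= (big_mkcond (fun i => i \in S))/=.
rewrite [in RHS](big_mkcond (fun i => i \in T))/= -big_split/=.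
apply: eq_bigr => i _; rewrite inE; case: (boolP (i \in S)) => iS /=.
  by rewrite (negbTE (ST _ iS)) mule1 HE.
by case: ifP => iT; rewrite mul1e// HF.
Qed.

(** The pi-system argument is applied twice, once in each block. *)
Lemma sigma_cylinders_independent (S T : {set I}) A B :
  (forall i, i \in S -> i \notin T) ->
  <<s cylinders S >> A -> <<s cylinders T >> B ->
  P (A `&` B) = (P A * P B)%E.
Proof.
move=> ST sA sB.
have mB : measurable B.
  apply: (smallest_sub _ (@cylinders_measurable T)) sB.
  exact: sigma_algebra_measurable.
apply: (@independent_g_sigma_algebra (cylinders S)) => //.
- exact: cylinders_measurable.
- exact: cylinders_setI.
- exact: cylinders_setT.
move=> C SC; rewrite setIC muleC.
apply: (@independent_g_sigma_algebra (cylinders T)) => //.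
- exact: cylinders_measurable.
- exact: cylinders_setI.
- exact: cylinders_setT.
- exact: cylinders_measurable SC.
move=> D TD; apply: cylinders_independent TD SC.
by move=> i iT; apply/negP => /ST; rewrite iT.
Qed.

End cylinders.
End blocks.

Section samples.
Context (R : realType) (d n : nat) (dO : measure_display).
Context (Omega : measurableType dO) (P : probability Omega R).
Local Notation Rd := (d.-tuple R).
Variables (Xdom : set Rd) (PX : probability Rd R).
Variables (X : 'I_n -> {RV P >-> Rd}) (eps : 'I_n -> {RV P >-> R}).
Variables (f0 : Rd -> R) (sigma : R) (h : R -> R).
Hypothesis model : regression_model Xdom PX X eps f0 sigma h.

Let G (i : 'I_n + 'I_n) : set (set Omega) :=
  match i with inl j => sigma_of (X j) | inr j => sigma_of (eps j) end.

Definition block (J : {set 'I_n}) : {set 'I_n + 'I_n} :=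
  [set i | match i with inl j => j \in J | inr j => j \in J end].

(** Measurability with respect to the sigma-algebra of a block of variables is
expressed by changing the measurable structure of the sample space. *)
Lemma block_measurable_subsample m (e : 'I_m -> 'I_n) (J : {set 'I_n}) :
  (forall i, e i \in J) ->
  measurable_fun [set: g_sigma_algebraType (cylinders G (block J))]
    (fun w => [tuple obs X eps f0 (e i) w | i < m]).
Proof.
move=> eJ; apply/measurable_fun_tnthP => i.
rewrite (_ : _ \o _ = obs X eps f0 (e i)); last first.
  by apply/funext => w; rewrite /= tnth_mktuple.
have GT k : G k setT.
  by case: k => j; exists setT; rewrite // preimage_setT setTI.
have mX : measurable_fun
    [set: g_sigma_algebraType (cylinders G (block J))] (X (e i)).
  move=> _ B mB; apply: sub_sigma_algebra.
  apply: (cylinders_one GT (i := inl (e i))) => //; first by rewrite inE.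
  by exists B.
have me : measurable_fun
    [set: g_sigma_algebraType (cylinders G (block J))] (eps (e i)).
  move=> _ B mB; apply: sub_sigma_algebra.
  apply: (cylinders_one GT (i := inr (e i))) => //; first by rewrite inE.
  by exists B.
apply: measurable_fun_pair => //; apply: measurable_funD => //.
exact: (measurableT_comp (rm_f0 model) mX).
Qed.

Lemma subsamples_independent m1 m2 (e1 : 'I_m1 -> 'I_n) (e2 : 'I_m2 -> 'I_n) :
  (forall i j, e1 i != e2 j) ->
  forall A B, measurable A -> measurable B ->
    let Z1 w := [tuple obs X eps f0 (e1 i) w | i < m1] in
    let Z2 w := [tuple obs X eps f0 (e2 i) w | i < m2] in
    P (Z1 @^-1` A `&` Z2 @^-1` B) = (P (Z1 @^-1` A) * P (Z2 @^-1` B))%E.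
Proof.
move=> e12 A B mA mB Z1 Z2.
pose J1 := [set e1 i | i : 'I_m1]; pose J2 := [set e2 i | i : 'I_m2].
apply: (@sigma_cylinders_independent _ _ _ P _ G _ _ _ _ (block J1) (block J2)).
- exact: rm_indep model.
- case=> j D [B' mB' <-] /=; rewrite setTI; exact: measurable_funPTI.
- by case=> j _ _ [B1 mB1 <-] [B2 mB2 <-]; exists (B1 `&` B2);
    rewrite ?preimage_setI ?setTI//; exact: measurableI.
- by case=> j; exists setT; rewrite // preimage_setT setTI.
- have disj j : j \in J1 -> j \in J2 -> False.
    move=> /imsetP[i1 _ ->] /imsetP[i2 _] e; move: (e12 i1 i2).
    by rewrite e eqxx.
  by case=> j; rewrite !inE => jJ; apply/negP => /(disj _ jJ).
- rewrite -[X in <<s _ >> X]setTI.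
  by apply: (block_measurable_subsample (J := J1)) => // i; rewrite imset_f.
- rewrite -[X in <<s _ >> X]setTI.
  by apply: (block_measurable_subsample (J := J2)) => // i; rewrite imset_f.
Qed.

Lemma measurable_subsample m (e : 'I_m -> 'I_n) :
  measurable_fun [set: Omega] (fun w => [tuple obs X eps f0 (e i) w | i < m]).
Proof.
apply/measurable_fun_tnthP => i.
rewrite (_ : _ \o _ = obs X eps f0 (e i)); last first.
  by apply/funext => w; rewrite /= tnth_mktuple.
apply: measurable_fun_pair => //; apply: measurable_funD => //.
exact: (measurableT_comp (rm_f0 model)).
Qed.

End samples.

(** * Conditioning on the first sample *)

Section two_stage.
Context (R : realType) (d : nat).
Local Notation Rd := (d.-tuple R).
Variables (PX : probability Rd R) (f0 : Rd -> R).
Hypothesis mf0 : measurable_fun [set: Rd] f0.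

Lemma sqnorm_integral (f : Rd -> R) :
  sqnorm PX f = (\int[PX]_x (f x ^+ 2)%:E)%E.
Proof.
rewrite /sqnorm unlock poweR12_sqrt; last first.
  by apply: integral_ge0 => x _; exact: poweR_ge0.
rewrite sqr_sqrte; last by apply: integral_ge0 => x _; exact: poweR_ge0.
apply: eq_integral => x _; change ((`|f x|%:E `^ 2)%E = (f x ^+ 2)%:E).
by rewrite poweR_EFin powR_mulrn// real_normK// num_real.
Qed.

Lemma sqdist_ge0 f g : (0 <= sqdist PX f g)%E.
Proof.
rewrite /sqdist sqnorm_integral; apply: integral_ge0 => x _.
by rewrite lee_fin sqr_ge0.
Qed.

(** Tonelli's theorem, as the squared distance is an integral over the design
point. *)
Lemma measurable_sqdist (dU : measure_display) (U : measurableType dU)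
    (g : U -> Rd -> R) :
  measurable_fun [set: U * Rd] (fun p => g p.1 p.2) ->
  measurable_fun [set: U] (fun u => sqdist PX (g u) f0).
Proof.
move=> mg; rewrite /sqdist; under eq_fun do rewrite sqnorm_integral.
apply: (@measurable_fun_fubini_tonelli_F _ _ U Rd R PX
  (fun p => ((g p.1 p.2 - f0 p.2) ^+ 2)%:E)).
  apply/measurable_EFinP/measurable_funX/measurable_funB => //.
  exact: (measurableT_comp mf0).
by move=> p; rewrite lee_fin sqr_ge0.
Qed.

Context (dO : measure_display) (Omega : measurableType dO).
Variable P : probability Omega R.

Section independent_samples.
Context (d1 d2 : measure_display).
Context (T1 : measurableType d1) (T2 : measurableType d2).
Variables (Z1 : Omega -> T1) (Z2 : Omega -> T2).
Hypothesis mZ1 : measurable_fun [set: Omega] Z1.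
Hypothesis mZ2 : measurable_fun [set: Omega] Z2.
Hypothesis Z12 : forall A B, measurable A -> measurable B ->
  P (Z1 @^-1` A `&` Z2 @^-1` B) = (P (Z1 @^-1` A) * P (Z2 @^-1` B))%E.

(** By independence the law of the pair is the product of the two laws, so
that Tonelli's theorem applies to it. *)
Lemma integral_independent (phi : T1 * T2 -> \bar R) :
  measurable_fun [set: T1 * T2] phi -> (forall z, 0 <= phi z)%E ->
  (\int[P]_w phi (Z1 w, Z2 w) = \int[P]_w \int[P]_w' phi (Z1 w, Z2 w'))%E.
Proof.
move=> mphi phi0.
pose pk1 : {RV P >-> T1} := HB.pack Z1 (isMeasurableFun.Build _ _ _ _ _ mZ1).
pose pk2 : {RV P >-> T2} := HB.pack Z2 (isMeasurableFun.Build _ _ _ _ _ mZ2).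
have mZ : measurable_fun [set: Omega] (fun w => (Z1 w, Z2 w)).
  exact: measurable_fun_pair.
pose pk : {RV P >-> (T1 * T2)%type} :=
  HB.pack (fun w => (Z1 w, Z2 w)) (isMeasurableFun.Build _ _ _ _ _ mZ).
have E A : measurable A -> (distribution P pk1 \x distribution P pk2)%E A
    = distribution P pk A.
  by apply: product_measure_unique => B C mB mC; exact: Z12.
transitivity (\int[distribution P pk]_z phi z)%E.
  by rewrite ge0_integral_pushforward.
transitivity (\int[distribution P pk1 \x distribution P pk2]_z phi z)%E.
  by apply: eq_measure_integral => A mA _; exact: esym (E A mA).
rewrite fubini_tonelli1// ge0_integral_pushforward//; last 2 first.
  exact: measurable_fun_fubini_tonelli_F.
  by move=> z _; apply: integral_ge0 => z' _; exact: phi0.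
apply: eq_integral => w _; rewrite /fubini_F /= ge0_integral_pushforward//.
exact: measurable_fun_pair2.
Qed.

(** The hypothesis bounds the conditional risk given the first sample. *)
Lemma two_stage_risk (ghat : T1 -> T2 -> Rd -> R) (g : T1 -> Rd -> R)
    (a b : R) :
  0 <= a -> 0 <= b ->
  measurable_fun [set: (T1 * T2) * Rd] (fun p => ghat p.1.1 p.1.2 p.2) ->
  measurable_fun [set: T1 * Rd] (fun p => g p.1 p.2) ->
  (forall z1, risk P PX f0 (fun w => ghat z1 (Z2 w))
              <= a%:E * (sqdist PX (g z1) f0 + b%:E))%E ->
  (risk P PX f0 (fun w => ghat (Z1 w) (Z2 w))
   <= a%:E * (risk P PX f0 (fun w => g (Z1 w)) + b%:E))%E.
Proof.
move=> a0 b0 mghat mg cond.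
pose phi z : \bar R := sqdist PX (ghat z.1 z.2) f0.
have mphi : measurable_fun [set: T1 * T2] phi.
  exact: (@measurable_sqdist _ (T1 * T2)%type (fun z => ghat z.1 z.2)).
have phi0 z : (0 <= phi z)%E by exact: sqdist_ge0.
have mgZ : measurable_fun [set: Omega] (fun w => sqdist PX (g (Z1 w)) f0).
  exact: (measurableT_comp (measurable_sqdist mg) mZ1).
rewrite /risk (integral_independent mphi phi0).
have -> : (a%:E * (\int[P]_w sqdist PX (g (Z1 w)) f0 + b%:E)
   = \int[P]_w (a%:E * (sqdist PX (g (Z1 w)) f0 + b%:E)))%E.
  rewrite ge0_integralZl//; last 2 first.
  - by apply: emeasurable_funD => //; exact: measurable_cst.
  - by move=> w _; rewrite adde_ge0// ?lee_fin// sqdist_ge0.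
  have Ib : (\int[P]_w b%:E = b%:E)%E.
    by rewrite integral_cst//= probability_setT mule1.
  rewrite ge0_integralD//= ?Ib//; last by move=> w _; exact: sqdist_ge0.
apply: ge0_le_integral => //.
- by move=> w _; apply: integral_ge0.
- apply: (measurableT_comp (f := fun z1 => \int[P]_w' phi (z1, Z2 w'))%E) mZ1.
  apply: (@measurable_fun_fubini_tonelli_F _ _ T1 Omega R P
    (fun p => phi (p.1, Z2 p.2))) => //.
  apply: (measurableT_comp mphi); apply: measurable_fun_pair => //.
  exact: (measurableT_comp mZ2).
- apply: emeasurable_funM; first exact: measurable_cst.
  by apply: emeasurable_funD => //; exact: measurable_cst.
by move=> w _; exact: cond.
Qed.

End independent_samples.
End two_stage.

(** * The prior weights *)

Section priors.
Context (R : realType).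

Lemma esum_option (K : countType) (a : option K -> \bar R) :
  (forall k, 0 <= a k)%E ->
  \esum_(k in [set: option K]) a k
  = (a None + \esum_(k in [set: K]) a (Some k))%E.
Proof.
move=> a0; rewrite (esumID [set None]); last by [].
rewrite setTI esum_set1// setTI.
rewrite -(esum_image [set: K] Some a); last by move=> x y _ _ [].
congr (_ + esum _ _)%E; rewrite eqEsubset; split=> [[k _|]|_ [k _ <-]] //=.
by exists k.
Qed.

(** The sum telescopes after comparison with
1 / (s (s + 1)) = 1 / s - 1 / (s + 1). *)
Lemma sum_inv_sqr_le1 k :
  \sum_(0 <= s < k | (1 <= s)%N) ((1 + s%:R) ^+ 2)^-1 <= 1 :> R.
Proof.
(* the telescoped bound, which is what the induction proves *)
suff H j : \sum_(0 <= s < j.+1 | (1 <= s)%N) ((1 + s%:R) ^+ 2)^-1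
           <= 1 - (j.+1%:R)^-1 :> R.
  case: k => [|j]; first by rewrite big_nil.
  by apply: le_trans (H j) _; rewrite lerBlDr lerDl invr_ge0.
elim: j => [|j IH]; first by rewrite big_mkcond big_nat1 /= invr1 subrr.
rewrite big_mkcond big_nat_recr//= -big_mkcond/=.
apply: le_trans (lerD IH (lexx _)) _.
have j0 : 0 < j.+1%:R :> R by [].
rewrite nat1r -[j.+2%:R]natr1; set x := j.+1%:R in j0 *.
rewrite -subr_ge0.
have -> : 1 - (x + 1)^-1 - (1 - x^-1 + ((x + 1) ^+ 2)^-1)
    = (x * (x + 1) ^+ 2)^-1.
  by field; apply/andP; split; rewrite gt_eqF// addr_gt0.
by rewrite invr_ge0 mulr_ge0 ?sqr_ge0// ltW.
Qed.

Lemma esum_inv_sqr_le (c : R) : 0 <= c ->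
  (\esum_(s in [set s : nat | (1 <= s)%N]) (c * ((1 + s%:R) ^+ 2)^-1)%:E
   <= c%:E)%E.
Proof.
move=> c0; rewrite -nneseries_esum; last first.
  by move=> s _; rewrite lee_fin mulr_ge0// invr_ge0 sqr_ge0.
apply: lime_le.
  apply: is_cvg_nneseries => s _ _.
  by rewrite lee_fin mulr_ge0// invr_ge0 sqr_ge0.
apply: nearW => k; rewrite sumEFin lee_fin -mulr_sumr -[leRHS]mulr1.
by rewrite ler_wpM2l// sum_inv_sqr_le1.
Qed.

Section sizes.
Variables (M n : nat).
Hypothesis M0 : (0 < minn M n)%N.

Definition size_weight (c : R) (J : {set 'I_M}) : R :=
  c * ((minn M n)%:R * 'C(M, #|J|)%:R)^-1.

Lemma size_weight_ge0 c J : 0 <= c -> 0 <= size_weight c J.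
Proof. by move=> c0; rewrite mulr_ge0// invr_ge0 mulr_ge0. Qed.

(** The sets of each size m share the mass c / min M n equally, and there are
min M n admissible sizes. *)
Lemma size_weight_sum c :
  \sum_(J : {set 'I_M} | admissible_size n M #|J|) size_weight c J = c.
Proof.
transitivity (\sum_(m < (minn M n).+1 | (1 <= m)%N) c * (minn M n)%:R^-1).
  rewrite (partition_big (fun J : {set 'I_M} => inord #|J|)
    (fun m : 'I_(minn M n).+1 => (1 <= m)%N)) => [|J]; last first.
    by rewrite /admissible_size => /andP[J1 JM]; rewrite inordK.
  apply: eq_bigr => m m1.
  have mM : (m <= M)%N by rewrite (leq_trans _ (geq_minl M n)) -1?ltnS.
  have C0 : 'C(M, m)%:R != 0 :> R by rewrite pnatr_eq0 -lt0n bin_gt0.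
  transitivity (\sum_(J : {set 'I_M} | #|J| == m)
    c * ((minn M n)%:R * 'C(M, m)%:R)^-1).
    rewrite /admissible_size.
    apply: eq_big => [J|J /andP[/andP[_ JM] /eqP <-]]; last first.
      by rewrite /size_weight inordK.
    apply/idP/eqP => [/andP[/andP[J1 JM] /eqP <-]|Jm]; first by rewrite inordK.
    by rewrite Jm m1 -ltnS ltn_ord inord_val eqxx.
  rewrite sumr_const.
  have -> : #|(fun J : {set 'I_M} => #|J| == m)| = 'C(M, m).
    by have := card_draws ('I_M) m; rewrite card_ord cardsE.
  rewrite -mulr_natr invfM; field.
  by rewrite C0 andbT pnatr_eq0 -lt0n.
rewrite big_mkcond big_ord_recl/= add0r sumr_const card_ord.
rewrite -[X in X = _]mulr_natr.
by rewrite divfK// pnatr_eq0 -lt0n.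
Qed.

Lemma size_weight_esum c : 0 <= c ->
  \esum_(J in [set J : {set 'I_M} | admissible_size n M #|J|])
    (size_weight c J)%:E = c%:E.
Proof.
move=> c0.
have w0 J : (0 <= (size_weight c J)%:E)%E by rewrite lee_fin size_weight_ge0.
rewrite esum_fset//; last exact: finite_finset.
rewrite -[in RHS](size_weight_sum c) -sumEFin.
rewrite (fsbigE (seq.filter (fun J : {set 'I_M} => admissible_size n M #|J|)
  (index_enum _))).
- rewrite big_filter_cond; apply: eq_bigl => J.
  by rewrite mem_setE andbb.
- by rewrite filter_uniq// index_enum_uniq.
- by move=> J /=; rewrite mem_filter => /andP[].
by move=> J aJ; rewrite mem_filter aJ mem_index_enum.
Qed.

Lemma T_prior_sub_probability p0 : 0 < p0 < 1 ->
  sub_probability (@T_prior R n M p0).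
Proof.
move=> /andP[p00 p01]; have q0 : 0 < 1 - p0 by rewrite subr_gt0.
split=> [[[J /= /andP[J1 JM]]|]|] //=.
  rewrite mulr_gt0// invr_gt0 mulr_gt0// ?ltr0n// bin_gt0.
  exact: leq_trans JM (geq_minl _ _).
rewrite esum_option//=; last first.
  move=> [J|] /=; rewrite lee_fin; last exact: ltW.
  by rewrite -/(size_weight (1 - p0) (val J)) size_weight_ge0// ltW.
rewrite (_ : esum _ _ = (1 - p0)%:E) ?subrKC// -?EFinD ?subrKC//.
rewrite -(size_weight_esum (ltW q0)).
rewrite -(esum_image [set: T_index n M] val
  (fun J => (size_weight (1 - p0) J)%:E)); last first.
  by move=> J K _ _; exact: val_inj.
congr (esum _ _); rewrite eqEsubset; split=> [_ [J _ <-]|J aJ].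
  exact: (valP J).
by exists (exist _ J aJ).
Qed.

Lemma AC_prior_size_weight p0 (k : AC_index n M) :
  AC_prior p0 (Some k)
  = size_weight (1 - p0) (val k).1 * ((1 + (val k).2%:R) ^+ 2)^-1.
Proof.
rewrite /AC_prior /size_weight -[RHS]mulrA.
by congr (_ * _); rewrite -[RHS]invfM; congr (_^-1); rewrite [RHS]mulrC mulrA.
Qed.

Lemma AC_prior_sub_probability p0 : 0 < p0 < 1 ->
  sub_probability (@AC_prior R n M p0).
Proof.
move=> /andP[p00 p01]; have q0 : 0 < 1 - p0 by rewrite subr_gt0.
have pos (k : AC_index n M) : 0 < AC_prior p0 (Some k).
  case: k => [[J s] /= /andP[/andP[J1 JM] s1]].
  rewrite mulr_gt0// invr_gt0 !mulr_gt0// ?exprn_gt0 ?ltr0n//.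
  by rewrite bin_gt0; exact: leq_trans JM (geq_minl _ _).
split=> [[k|]|] //=; first exact: pos.
rewrite esum_option//=; last first.
  by move=> [k|] /=; rewrite lee_fin ltW//; exact: pos.
rewrite -[leRHS](_ : (p0%:E + (1 - p0)%:E)%E = _); last first.
  by rewrite -EFinD subrKC.
rewrite leeD2l// -(size_weight_esum (ltW q0)).
pose a (J : {set 'I_M}) (s : nat) : \bar R :=
  (size_weight (1 - p0) J * ((1 + s%:R) ^+ 2)^-1)%:E.
rewrite (eq_esum (b := fun k : AC_index n M => a (val k).1 (val k).2));
  last first.
  by move=> k _; congr EFin; exact: AC_prior_size_weight.
rewrite -(esum_image [set: AC_index n M] val (fun k => a k.1 k.2)); last first.
  by move=> J K _ _; exact: val_inj.
rewrite (_ : [set val k | k in [set: AC_index n M]]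
  = [set J : {set 'I_M} | admissible_size n M #|J|]
    `*`` (fun=> [set s | (1 <= s)%N])); last first.
  rewrite eqEsubset; split=> [_ [[k /= /andP[k1 k2]] _ <-] //|k [k1 k2]].
  by exists (exist _ k (introT andP (conj k1 k2))).
rewrite -esum_esum; last first.
  move=> J s _ _.
  by rewrite lee_fin mulr_ge0 ?size_weight_ge0 ?invr_ge0 ?sqr_ge0// ltW.
apply: le_esum => J _; apply: esum_inv_sqr_le.
by rewrite size_weight_ge0// ltW.
Qed.

End sizes.
End priors.

(** * Risk of the aggregate *)

Section scaled_infima.
Context (R : realType).

Lemma le_mul_ereal_inf (T : Type) (A : set T) (c : R) (x : T -> \bar R)
    (a : \bar R) :
  0 < c -> (forall t, A t -> a <= c%:E * x t)%E ->
  (a <= c%:E * ereal_inf [set x t | t in A])%E.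
Proof.
move=> c0 ax; rewrite -lee_pdivrMl//; apply: le_ereal_inf_tmp => _ [t At <-].
by rewrite lee_pdivrMl//; exact: ax.
Qed.

Lemma le_affine_ereal_inf (T : Type) (A : set T) (c b : R) (x : T -> \bar R)
    (a : \bar R) :
  0 < c -> (forall t, A t -> a <= c%:E * x t + b%:E)%E ->
  (a <= c%:E * ereal_inf [set x t | t in A] + b%:E)%E.
Proof.
move=> c0 ax; rewrite -leeBlDr//; apply: le_mul_ereal_inf => // t At.
by rewrite leeBlDr//; exact: ax.
Qed.

End scaled_infima.

Section strategy.
Context (R : realType) (d n n1 : nat) (hn1n : (n1 < n)%N).
Context (dO : measure_display) (Omega : measurableType dO).
Variable P : probability Omega R.
Local Notation Rd := (d.-tuple R).
Variables (Xdom : set Rd) (PX : probability Rd R).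
Variables (X : 'I_n -> {RV P >-> Rd}) (eps : 'I_n -> {RV P >-> R}).
Variables (f0 : Rd -> R) (sigma : R) (h : R -> R).
Hypothesis model : regression_model Xdom PX X eps f0 sigma h.
Variable L : R.
Local Notation N := (n - n1)%N.
Local Notation Z1 := (sample1 X eps f0 (ltnW hn1n)).
Local Notation Z2 := (sample2 X eps f0 (ltnW hn1n)).

(** The common form of the guarantees of the two algorithms. *)
Definition aggregation_bound (c0 c3 : R) (G : aggregation R d N) : Prop :=
  forall (K : countType) (w : K -> R) (f : K -> Rd -> R),
    sub_probability w -> bounded_candidates Xdom L f -> forall k,
    (risk P PX f0 (fun om => G K w f (Z2 om))
     <= c0%:E * (sqdist PX (f k) f0
                 + (c3 * ((1 + ln (1 / w k)) / N%:R))%:E))%E.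

Lemma sub_probability_le1 (K : countType) (w : K -> R) k :
  sub_probability w -> w k <= 1.
Proof.
move=> [w0 w1]; rewrite -lee_fin; apply: le_trans w1.
apply: esum_ge; exists [set k]; first by split.
by rewrite fsbig_set1.
Qed.

Lemma log_inv_weight_ge0 (K : countType) (w : K -> R) k :
  sub_probability w -> 0 <= ln (1 / w k).
Proof.
move=> sw; have [w0 _] := sw.
by rewrite ln_ge0// ler_pdivlMr// mul1r sub_probability_le1.
Qed.

Let N0 : 0 < N%:R :> R.
Proof. by rewrite ltr0n subn_gt0. Qed.

Lemma catoni_aggregation_bound lam : 0 < lam ->
  catoni_guarantee P Xdom PX f0 L Z2 lam ->
  aggregation_bound 1 (2 / lam) (@catoni R d N lam).
Proof.
move=> lam0 guar K w f sw bf k; apply: le_trans (guar K w f sw bf) _.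
apply: le_trans (ereal_inf_lbound _) _; first by exists k.
rewrite mul1e leeD2l// lee_fin.
(* the 1 beside the logarithm contributes the nonnegative second term *)
rewrite [leRHS](_ : _ = 2 / (N%:R * lam) * ln (1 / w k) + 2 / (N%:R * lam)).
  by rewrite lerDl divr_ge0// mulr_ge0// ltW.
by field; rewrite !gt_eqF //.
Qed.

Lemma arm_aggregation_bound v slo shi CY : 0 < CY ->
  arm_guarantee P Xdom PX f0 L Z2 v sigma slo shi h CY ->
  aggregation_bound CY (sigma ^+ 2) (@arm R d N v sigma slo shi h).
Proof.
move=> CY0 guar K w f sw bf k; apply: le_trans (guar K w f sw bf) _.
rewrite lee_pmul2l//; apply: ereal_inf_lbound; exists k => //.
by congr (_ + _%:E)%E; rewrite mulrA mulrAC.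
Qed.

(** The inverse is taken of a positive number: [U] bounds the mean of an
exponential that is at least 1, and [V] bounds a quotient of nonnegative
means. *)
Lemma lambdaC_gt0 (i : 'I_n) alpha U V : 0 < L ->
  cond_C1 eps alpha U -> cond_C2 eps alpha V -> 0 < lambdaC L alpha U V.
Proof.
move=> L0 [a0 /(_ i) EU] [_ /(_ i) EV].
have mexp : measurable_fun [set: Omega] (fun w => expR (alpha * `|eps i w|)).
  apply: (measurableT_comp (f := expR)); first exact: measurable_expR.
  apply: measurable_funM; first exact: measurable_cst.
  by apply: (measurableT_comp (@normr_measurable R setT)).
have U1 : 1 <= U.
  rewrite -lee_fin; apply: le_trans EU; rewrite unlock.
  rewrite -[leLHS](_ : (\int[P]_w 1%:E = 1%:E)%E); last first.
    by rewrite integral_cst//= probability_setT mule1.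
  apply: ge0_le_integral => //.
  - exact/measurable_EFinP.
  move=> w _ /=; rewrite lee_fin; rewrite -[leLHS]expR0 ler_expR.
  by rewrite mulr_ge0// ltW.
have V0 : 0 <= V.
  rewrite -lee_fin; apply: le_trans EV; apply: mule_ge0.
    rewrite unlock; apply: integral_ge0 => w _ /=.
    by rewrite lee_fin mulr_ge0 ?sqr_ge0// expR_ge0.
  rewrite inve_ge0 unlock; apply: integral_ge0 => w _ /=.
  by rewrite lee_fin expR_ge0.
rewrite /lambdaC lt_min divr_gt0 ?mulr_gt0// invr_gt0 mulr_gt0//.
  exact: lt_le_trans U1.
by rewrite ltr_pwDl ?mulr_gt0 ?exprn_gt0// mulr_ge0.
Qed.

(** The aggregation guarantee is applied with the first sample held fixed, and
then integrated over that sample. *)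
Lemma aggregate_risk (G : aggregation R d N) (c0 c3 : R) (K : countType)
    (w : K -> R) (g : K -> n1.-tuple (Rd * R) -> Rd -> R) (k : K) :
  jointly_measurable G -> aggregation_bound c0 c3 G -> 0 <= c0 -> 0 <= c3 ->
  sub_probability w -> (forall k, bounded_estimator Xdom L (g k)) ->
  (risk P PX f0 (fun om => G K w (fun k => g k (Z1 om)) (Z2 om))
   <= c0%:E * (risk P PX f0 (fun om => g k (Z1 om))
               + (c3 * ((1 + ln (1 / w k)) / N%:R))%:E))%E.
Proof.
move=> mG bG c00 c30 sw bg.
pose e1 i : 'I_n := cast_ord (subnKC (ltnW hn1n)) (lshift N i).
pose e2 i : 'I_n := cast_ord (subnKC (ltnW hn1n)) (rshift n1 i).
have e12 i j : e1 i != e2 j.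
  by rewrite -val_eqE/= neq_ltn (leq_trans (ltn_ord i) (leq_addr _ _)).
apply: (two_stage_risk (rm_f0 model) (measurable_subsample model e1)
  (measurable_subsample model e2) (subsamples_independent model e12)
  (ghat := fun z1 z2 => G K w (fun k => g k z1) z2)) => //.
- by rewrite mulr_ge0// divr_ge0// addr_ge0// log_inv_weight_ge0.
- apply: (mG _ ((n1.-tuple (Rd * R) * N.-tuple (Rd * R)) * Rd)%type K w
    (fun k p => g k p.1.1) (fun p => p.1.2) snd) => //.
  + move=> j; apply: (measurableT_comp (bg j).1 (g := fun q => (q.1.1.1, q.2))).
    apply: measurable_fun_pair => //.
    apply: (measurableT_comp measurable_fst).
    exact: (measurableT_comp measurable_fst).
  + exact: (measurableT_comp measurable_snd measurable_fst).
- exact: (bg k).1.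
move=> z1; apply: bG => // j; split.
  apply: (measurableT_comp (bg j).1 (g := fun x => (z1, x))).
  by apply: measurable_fun_pair.
apply: ge_ereal_sup => _ [x Xx <-]; rewrite lee_fin.
exact: (bg j).2.
Qed.

End strategy.

(** * Oracle inequalities *)

Section oracle.
Context (R : realType) (d n M n1 : nat).
Hypotheses (M0 : (0 < M)%N) (hn1n : (n1 < n)%N).
Context (dO : measure_display) (Omega : measurableType dO).
Variable P : probability Omega R.
Local Notation Rd := (d.-tuple R).
Variables (Xdom : set Rd) (PX : probability Rd R).
Variables (X : 'I_n -> {RV P >-> Rd}) (eps : 'I_n -> {RV P >-> R}).
Variables (f0 : Rd -> R) (sigma : R) (h : R -> R).
Hypothesis model : regression_model Xdom PX X eps f0 sigma h.
Variables (L p0 : R).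
Hypotheses (L0 : 0 < L) (hp0 : 0 < p0 < 1).
Variable F : 'I_M -> Rd -> R.
Local Notation N := (n - n1)%N.
Local Notation Z1 := (sample1 X eps f0 (ltnW hn1n)).
Local Notation Z2 := (sample2 X eps f0 (ltnW hn1n)).
Variables (G : aggregation R d N) (c0 c3 : R).
Hypothesis mG : jointly_measurable G.
Hypothesis bG : aggregation_bound hn1n Xdom PX X eps f0 L c0 c3 G.
Hypotheses (c00 : 0 < c0) (c30 : 0 <= c3).

Let minn0 : (0 < minn M n)%N.
Proof. by rewrite leq_min M0 (leq_ltn_trans _ hn1n). Qed.

Let q0 : 0 < 1 - p0.
Proof. by case/andP: hp0 => _; rewrite subr_gt0. Qed.

Let sqdist_null : sqdist PX (fun=> 0) f0 = sqnorm PX f0.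
Proof.
rewrite /sqdist !sqnorm_integral; apply: eq_integral => x _.
by rewrite sub0r sqrrN.
Qed.

Let null_estimator_bounded : bounded_estimator Xdom L
  (fun (_ : n1.-tuple (Rd * R)) (_ : Rd) => 0 : R).
Proof.
split; first exact: measurable_cst.
by move=> z x _; rewrite normr0 ltW.
Qed.

Lemma null_oracle_inequality (K : countType) (w : option K -> R)
    (g : option K -> n1.-tuple (Rd * R) -> Rd -> R) :
  sub_probability w -> (forall k, bounded_estimator Xdom L (g k)) ->
  w None = p0 -> g None = (fun _ _ => 0) ->
  (risk P PX f0 (fun om => G w (fun k => g k (Z1 om)) (Z2 om))
   <= c0%:E * null_bound n PX f0 n1 p0 c3)%E.
Proof.
move=> sw bg wN gN.
have := aggregate_risk model None mG bG (ltW c00) c30 sw bg.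
rewrite wN /null_bound.
have -> : risk P PX f0 (fun om => g None (Z1 om)) = sqnorm PX f0.
  by rewrite gN /risk sqdist_null integral_cst//= probability_setT mule1.
by rewrite div1r lnV// posrE; case/andP: hp0.
Qed.

Lemma log_inv_size_weight (J : {set 'I_M}) : (#|J| <= M)%N ->
  ln (1 / size_weight n (1 - p0) J)
  = ln 'C(M, #|J|)%:R + ln (minn M n)%:R - ln (1 - p0).
Proof.
move=> JM; have C0 : 0 < 'C(M, #|J|)%:R :> R by rewrite ltr0n bin_gt0.
have m0 : 0 < (minn M n)%:R :> R by rewrite ltr0n.
rewrite /size_weight div1r invfM invrK lnM ?posrE ?invr_gt0 ?mulr_gt0//.
rewrite lnV ?posrE// lnM ?posrE//; ring.
Qed.

(** For each admissible [J] the candidate with index [J] gives the bound with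
[J] in place of the infimum. *)
Lemma T_oracle_inequality (CT : R)
    (fT : {set 'I_M} -> n1.-tuple (Rd * R) -> Rd -> R) :
  0 < CT -> T_estimators n F Xdom PX f0 L P Z1 CT fT ->
  (risk P PX f0 (fun w => T_strategy n G p0 fT (Z1 w) (Z2 w))
   <= T_oracle n F PX f0 n1 p0 c0 CT CT c3)%E.
Proof.
move=> CT0 estT.
pose g (k : option (T_index n M)) z1 := T_candidates (fun J => fT J z1) k.
have bg k : bounded_estimator Xdom L (g k).
  by case: k => [[J aJ]|] //; exact: (estT J aJ).1.
have sw := @T_prior_sub_probability R M n minn0 p0 hp0.
rewrite /T_oracle le_min; apply/andP; split; last first.
  exact: (null_oracle_inequality sw bg).
apply: le_mul_ereal_inf => // m am.
(* with c0 on the left the right side is affine in the inner infimum *)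
rewrite -lee_pdivrMl//; apply: le_affine_ereal_inf => // J /= Jm.
rewrite lee_pdivrMl//.
have aJ : admissible_size n M #|J| by rewrite Jm.
have := aggregate_risk model (Some (exist _ J aJ)) mG bG (ltW c00) c30 sw bg.
move=> /le_trans; apply; rewrite lee_pmul2l//.
apply: le_trans (leeD (estT J aJ).2 (lexx _)) _.
have JM : (#|J| <= M)%N.
  by move: aJ; rewrite /admissible_size leq_min => /and3P[].
rewrite muleDr//; last exact: fin_num_adde_defl; rewrite -addeA leeD2l//.
rewrite -EFinM -EFinD lee_fin Jm /oracle_penalty.
rewrite -/(size_weight n (1 - p0) J) log_inv_size_weight// Jm.
by rewrite lerD2l !addrA.
Qed.

(** Two functions bounded by L differ by at most 2 L; a pair of equal functions
at a design point gives the lower bound. *)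
Lemma ball_width_bounds (J : {set 'I_M}) s : Xdom !=set0 ->
  0 <= ball_width F Xdom L J s <= 2 * L.
Proof.
move=> [x0 Xx0].
have sup_le (f : Rd -> R) x :
    (supnorm Xdom f <= L%:E)%E -> Xdom x -> `|f x| <= L.
  move=> fL Xx; rewrite -lee_fin; apply: le_trans fL.
  by apply: ereal_sup_ubound; exists x.
rewrite /ball_width; set A := (X in sup X).
have A2 r : A r -> r <= 2 * L.
  move=> [f [g [x [[_ [_ _ fL]] [_ [_ _ gL]] Xx ->]]]].
  apply: le_trans (ler_normB _ _) _; rewrite mulrDl mul1r.
  by rewrite lerD// sup_le.
have A0 : A 0.
  have z : ball_class F Xdom L J s (lincomb F J (fun=> 0)).
    exists (fun=> 0); split => //.
      by rewrite big1 ?ler0n// => j _; rewrite normr0.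
    apply: ge_ereal_sup => _ [x _ <-]; rewrite lee_fin /lincomb.
    by rewrite big1 ?normr0 ?ltW// => j _; rewrite mul0r.
  exists (lincomb F J (fun=> 0)), (lincomb F J (fun=> 0)), x0.
  by rewrite subrr normr0.
apply/andP; split.
  by apply: sup_upper_bound => //; split; [exists 0|exists (2 * L)].
by apply: ge_sup => //; exists 0.
Qed.

(** The left side increases with [H]; for H = 2 L the difference of the sides
is 4 (t - L)^2, where t^2 = s2 + 4 L^2. *)
Lemma AC_constant_le (s2 H : R) : 0 <= s2 -> 0 <= H <= 2 * L ->
  (2 * Num.sqrt (s2 + 4 * L ^+ 2) + H) ^+ 2 <= 8 * (s2 + 5 * L ^+ 2).
Proof.
move=> s20 /andP[H0 H2].
set t := Num.sqrt _.
have t0 : 0 <= t by exact: sqrtr_ge0.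
have t2 : t ^+ 2 = s2 + 4 * L ^+ 2.
  by rewrite sqr_sqrtr// addr_ge0// mulr_ge0// sqr_ge0.
have -> : 8 * (s2 + 5 * L ^+ 2) = 8 * (t ^+ 2 + L ^+ 2) by rewrite t2; ring.
apply: (@le_trans _ _ ((2 * t + 2 * L) ^+ 2)).
  by rewrite lerXn2r ?nnegrE ?addr_ge0 ?mulr_ge0 ?(ltW L0)// lerD2l.
rewrite -subr_ge0 (_ : _ - _ = 4 * (t - L) ^+ 2); last by ring.
by rewrite mulr_ge0// sqr_ge0.
Qed.

(** As for T-estimators, with one candidate for each pair (J, s); the factor
(1 + s)^2 of the weight is the source of the penalty 2 log (1 + s). *)
Lemma AC_oracle_inequality (c : R)
    (fAC : {set 'I_M} -> nat -> n1.-tuple (Rd * R) -> Rd -> R) :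
  0 < c -> AC_estimators n F Xdom PX f0 sigma L P Z1 c fAC ->
  (risk P PX f0 (fun w => AC_strategy n G p0 fAC (Z1 w) (Z2 w))
   <= AC_oracle n F Xdom PX f0 L n1 p0 c0 1
        (8 * c * (sigma ^+ 2 + 5 * L ^+ 2)) c3)%E.
Proof.
move=> cpos estAC.
pose g (k : option (AC_index n M)) z1 :=
  AC_candidates (fun J s => fAC J s z1) k.
have bg k : bounded_estimator Xdom L (g k).
  case: k => [[[J s] aJs]|] //; have /andP[aJ s1] := aJs.
  exact: (estAC J s aJ s1).1.
have sw := @AC_prior_sub_probability R M n minn0 p0 hp0.
have Xdom0 : Xdom !=set0.
  apply/set0P/eqP => X0; have := rm_supp model.
  by rewrite X0 measure0 => /eqP; rewrite eqe eq_sym oner_eq0.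
rewrite /AC_oracle le_min; apply/andP; split; last first.
  exact: (null_oracle_inequality sw bg).
apply: le_mul_ereal_inf => // m am.
rewrite -lee_pdivrMl// /AC_approx; apply: le_affine_ereal_inf => // J /= Jm.
apply: le_affine_ereal_inf => // s /= s1.
rewrite mul1e lee_pdivrMl//.
have aJ : admissible_size n M #|J| by rewrite Jm.
have aJs : admissible_size n M #|(J, s).1| && (1 <= (J, s).2)%N.
  by rewrite /= aJ.
have := aggregate_risk model (Some (exist _ (J, s) aJs))
  mG bG (ltW c00) c30 sw bg.
move=> /le_trans; apply; rewrite lee_pmul2l//.
apply: le_trans (leeD (estAC J s aJ s1).2 (lexx _)) _.
have JM : (#|J| <= M)%N.
  by move: aJ; rewrite /admissible_size leq_min => /and3P[].
rewrite -!addeA leeD2l// -!EFinD lee_fin Jm /oracle_penalty.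
have s0 : 0 < (1 + s%:R) ^+ 2 :> R by rewrite exprn_gt0// ltr_pwDl.
have wpos : 0 < size_weight n (1 - p0) J.
  by rewrite mulr_gt0// invr_gt0 mulr_gt0// ltr0n// bin_gt0.
rewrite AC_prior_size_weight /=.
have -> : ln (1 / (size_weight n (1 - p0) J / (1 + s%:R) ^+ 2))
    = ln (1 / size_weight n (1 - p0) J) + 2 * ln (1 + s%:R).
  rewrite !div1r invfM invrK lnM ?posrE ?invr_gt0// lnXn ?mulr_natl//.
rewrite log_inv_size_weight// Jm.
rewrite [leRHS](_ : _ = 8 * c * (sigma ^+ 2 + 5 * L ^+ 2) * (m%:R / n1%:R)
  + c3 * ((1 + (ln 'C(M, m)%:R + ln (minn M n)%:R - ln (1 - p0)
     + 2 * ln (1 + s%:R))) / N%:R)); last by ring.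
rewrite lerD2r ler_wpM2r ?divr_ge0//.
rewrite -[leRHS]mulrA [leRHS]mulrCA.
rewrite ler_pM2l//; apply: AC_constant_le; first exact: sqr_ge0.
exact: ball_width_bounds.
Qed.

End oracle.

Theorem theorem12
  (R : realType) (d n M n1 : nat)
  (hn : (2 <= n)%N) (hM : (2 <= M)%N) (hn1 : (1 <= n1)%N) (hn1n : (n1 < n)%N)
  (dO : measure_display) (Omega : measurableType dO) (P : probability Omega R)
  (Xdom : set (d.-tuple R)) (PX : probability (d.-tuple R) R)
  (X : 'I_n -> {RV P >-> d.-tuple R}) (eps : 'I_n -> {RV P >-> R})
  (f0 : d.-tuple R -> R) (sigma : R) (h : R -> R)
  (model : regression_model Xdom PX X eps f0 sigma h)
  (F : 'I_M -> d.-tuple R -> R)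
  (F_meas : forall j, measurable_fun [set: d.-tuple R] (F j))
  (F_norm : forall j, ('N[PX]_(2%:R)%:E [EFin \o F j] <= 1)%E)
  (p0 : R) (hp0 : 0 < p0 < 1) (L : R)
  (* C_{L,sigma}; c; C_Y as a function of the bounds on sigma, of L and of h *)
  (CT : R -> R -> R) (c : R) (CY : R -> R -> R -> (R -> R) -> R)
  (CT_gt0 : forall l s, 0 < CT l s) (c_gt0 : 0 < c)
  (CY_gt0 : forall a b l g, 0 < CY a b l g)
  (fT : {set 'I_M} -> n1.-tuple (d.-tuple R * R) -> d.-tuple R -> R)
  (fAC : {set 'I_M} -> nat -> n1.-tuple (d.-tuple R * R) -> d.-tuple R -> R) :
  let Z1 := sample1 X eps f0 (ltnW hn1n) in
  let Z2 := sample2 X eps f0 (ltnW hn1n) in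
  let riskT (G : aggregation R d (n - n1)) :=
    risk P PX f0 (fun w => T_strategy n G p0 fT (Z1 w) (Z2 w)) in
  let riskAC (G : aggregation R d (n - n1)) :=
    risk P PX f0 (fun w => AC_strategy n G p0 fAC (Z1 w) (Z2 w)) in
  [/\ (* T-C *)
      forall alpha U V : R,
        cond_BD Xdom f0 L -> cond_T1 eps sigma -> cond_T2 sigma ->
        cond_C1 eps alpha U -> cond_C2 eps alpha V ->
        T_estimators n F Xdom PX f0 L P Z1 (CT L sigma) fT ->
        catoni_guarantee P Xdom PX f0 L Z2 (lambdaC L alpha U V) ->
        (riskT (catoni (lambdaC L alpha U V))
         <= T_oracle n F PX f0 n1 p0
              1 (CT L sigma) (CT L sigma) (2 / lambdaC L alpha U V))%E,
      (* T-Y *)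
      forall (v : arm_version) (slo shi : R),
        cond_BD Xdom f0 L -> cond_T1 eps sigma -> cond_T2 sigma ->
        cond_Y1 sigma slo shi ->
        T_estimators n F Xdom PX f0 L P Z1 (CT L sigma) fT ->
        arm_guarantee P Xdom PX f0 L Z2 v sigma slo shi h (CY slo shi L h) ->
        (riskT (arm v sigma slo shi h)
         <= T_oracle n F PX f0 n1 p0
              (CY slo shi L h) (CT L sigma) (CT L sigma) (sigma ^+ 2))%E,
      (* AC-C *)
      forall alpha U V : R,
        cond_BD Xdom f0 L -> cond_C1 eps alpha U -> cond_C2 eps alpha V ->
        AC_estimators n F Xdom PX f0 sigma L P Z1 c fAC ->
        catoni_guarantee P Xdom PX f0 L Z2 (lambdaC L alpha U V) ->
        (riskAC (catoni (lambdaC L alpha U V))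
         <= AC_oracle n F Xdom PX f0 L n1 p0
              1 1 (8 * c * (sigma ^+ 2 + 5 * L ^+ 2))
              (2 / lambdaC L alpha U V))%E
    & (* AC-Y *)
      forall (v : arm_version) (slo shi : R),
        (* sigma is known exactly when the bounds coincide *)
        (v = ArmKnownSigma -> slo = shi) ->
        cond_BD Xdom f0 L -> cond_Y1 sigma slo shi -> cond_Y2 h ->
        AC_estimators n F Xdom PX f0 sigma L P Z1 c fAC ->
        arm_guarantee P Xdom PX f0 L Z2 v sigma slo shi h (CY slo shi L h) ->
        (riskAC (arm v sigma slo shi h)
         <= AC_oracle n F Xdom PX f0 L n1 p0
              (CY slo shi L h) 1 (8 * c * (sigma ^+ 2 + 5 * L ^+ 2))
              (sigma ^+ 2))%E].
Proof.
move=> Z1 Z2 riskT riskAC.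
have M0 : (0 < M)%N by exact: ltnW.
have n0 : (0 < n)%N by exact: ltnW.
have mh := rm_h_meas model.
split.
- move=> alpha U V [L0 _] _ _ C1 C2 estT guar.
  have lam0 := lambdaC_gt0 (Ordinal n0) L0 C1 C2.
  apply: (T_oracle_inequality M0 model L0 hp0
    (@catoni_jointly_measurable _ _ _ _)
    (catoni_aggregation_bound lam0 guar)) => //.
  by rewrite divr_ge0// ltW.
- move=> v slo shi [L0 _] _ _ _ estT guar.
  apply: (T_oracle_inequality M0 model L0 hp0
    (@arm_jointly_measurable _ _ _ v sigma slo shi h mh)
    (arm_aggregation_bound (CY_gt0 slo shi L h) guar)) => //.
  exact: sqr_ge0.
- move=> alpha U V [L0 _] C1 C2 estAC guar.
  have lam0 := lambdaC_gt0 (Ordinal n0) L0 C1 C2.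
  apply: (AC_oracle_inequality M0 model L0 hp0
    (@catoni_jointly_measurable _ _ _ _)
    (catoni_aggregation_bound lam0 guar)) => //.
  by rewrite divr_ge0// ltW.
- move=> v slo shi _ [L0 _] _ _ estAC guar.
  apply: (AC_oracle_inequality M0 model L0 hp0
    (@arm_jointly_measurable _ _ _ v sigma slo shi h mh)
    (arm_aggregation_bound (CY_gt0 slo shi L h) guar)) => //.
  exact: sqr_ge0.
Qed.
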